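(* Let $1\le d_1\le\dots\le d_m$ be integers, $k=\sum_{i=1}^m(d_i-1)$ and $F=\{0,\dots,d_1-1\}\times\cdots\times\{0,\dots,d_m-1\}$. For $v\le k$, let $S\subseteq F_{\le v}$ with $|S|=r$, and let $M(r)$ denote the set of the first $r$ elements of $F_{\le v}$ in descending lexicographic order. Then $|\Delta(M(r))|\le|\Delta(S)|$.
   Context: For $a=(i_1,\dots,i_m)\in F$, $\deg(a)=i_1+\cdots+i_m$; $F_{\le v}=\{a\in F:\deg(a)\le v\}$. The partial order $\le_P$ on $F$ is coordinatewise: $(i_1,\dots,i_m)\le_P(j_1,\dots,j_m)$ iff $i_1\le j_1,\dots,i_m\le j_m$. The shadow of $S\subseteq F$ is $\Delta(S)=\{a\in F:\exists\, b\in S,\ b\le_P a\}$. Lexicographic order: $a<_{lex}b$ iff the first nonzero coordinate of $b-a$ is positive; the ''first $r$ elements in descending lexicographic order'' are the $r$ lexicographically largest elements. *)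

(* Defs.v *)
From mathcomp Require Import all_boot.

Set Implicit Arguments.
Unset Strict Implicit.
Unset Printing Implicit Defensive.

Notation box d := {dffun forall i, 'I_(d i)}.

Section Box.
Variables (m : nat) (d : 'I_m -> nat).
Implicit Types (a b : box d) (S : {set box d}).

Definition deg a : nat := \sum_(i < m) a i.

Definition deg_le (v : nat) : {set box d} := [set a | deg a <= v].

Definition leP a b : bool := [forall i, a i <= b i].

Definition shadow S : {set box d} := [set a | [exists b in S, leP b a]].

Definition ltlex a b : bool :=
  [exists i, (a i < b i) && [forall j : 'I_m, (j < i) ==> (a j == b j)]].

Definition gelex a b : bool := (a == b) || ltlex b a.

(* This is all of [deg_le v] when [r] exceeds its cardinal. *)
Definition lex_first (v r : nat) : {set box d} :=
  [set:: take r (sort gelex (enum (deg_le v)))].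

End Box.

(* Main.v *)
Require Import Defs.
From mathcomp Require Import all_boot.
From mathcomp Require Import zify.

Set Implicit Arguments.
Unset Strict Implicit.
Unset Printing Implicit Defensive.

(** The shadow of [S] is an up-closed set, and [S] lies in its part of degree
    at most [v]. The theorem follows from a statement about up-closed sets
    [U]: among those of a given size, the set [L] of the lexicographically
    largest points has the most elements of degree at most [v], for every [v]
    at once ([lex_dominates]). Applied to the shadow of [S], it gives an [L] of
    the same size as the shadow with at least [r] points of degree at most [v];
    as [L] is closed under passing to lexicographically larger points, it
    contains the first [r] of them. It is also up-closed, because the
    lexicographic order extends [<=P], so it contains their shadow too.

    The domination statement is proved by improving [U] until it is closed
    under passing to larger points. An improvement keeps the size and the
    up-closedness, leaves no fewer points of degree at most [v] for any [v], and
    decreases the sum over [U] of the numbers of points lexicographically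
    above. Three improvements suffice.

    - If some slice [{a | a i = j}] of [U] is not an upper lexicographic segment
      of that slice of the box, all slices in direction [i] are replaced by
      segments, by induction on the number of coordinates
      ([slice_compression]).
    - Let [y] be the least point of [U] and [x] the greatest point outside [U].
      If [deg x <= deg y], then [y] is exchanged for [x]
      ([extremal_exchange]). When there are at least three coordinates and all
      slices are segments already, this degree condition always holds
      ([slice_closed_exchange]).
    - With two coordinates, slices carry no information. If [deg y < deg x],
      part of [U] is folded along a diagonal: a degree-preserving reflection
      sends points to lexicographically larger ones whenever the target is
      free ([reflection_compression]). The ordering of the side lengths is what
      keeps this reflection inside the box. *)

Local Notation "a <=P b" := (Defs.leP a b) (at level 70).

(** * The lexicographic order *)

Section Lex.
Variables (m : nat) (d : 'I_m -> nat).
Implicit Types (a b c p x y z : box d) (i k : 'I_m).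
Implicit Types (A : {set 'I_m}) (B L U V W : {set box d}).

Lemma boxP a b : (forall k, a k = b k :> nat) -> a = b.
Proof. by move=> ab; apply/ffunP => k; apply/val_inj/ab. Qed.

(** An out-of-range [n] leaves [a] unchanged, so that [upd] is total on plain
    natural numbers. *)
Definition upd a i n : box d :=
  [ffun k => insubd (a k) (if k == i then n else nat_of_ord (a k))].

Lemma updE a i n k :
  n < d i -> upd a i n k = (if k == i then n else nat_of_ord (a k)) :> nat.
Proof.
move=> n_lt; rewrite ffunE val_insubd; case: eqP => [->|_]; first by rewrite n_lt.
by rewrite ltn_ord.
Qed.

Lemma lePP a b : reflect (forall i, a i <= b i) (a <=P b).
Proof. exact: forallP. Qed.

Lemma leP_refl a : a <=P a.
Proof. by apply/lePP. Qed.

Lemma leP_trans a b c : a <=P b -> b <=P c -> a <=P c.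
Proof.
by move=> /lePP ab /lePP bc; apply/lePP => i; apply: leq_trans (ab i) (bc i).
Qed.

Lemma ltlexP a b :
  reflect (exists2 i, a i < b i & forall j : 'I_m, j < i -> a j = b j :> nat)
          (ltlex a b).
Proof.
apply: (iffP existsP) => [[i /andP[lt_ab /forallP eq_ab]]|[i lt_ab eq_ab]].
  by exists i => // j ji; have /implyP/(_ ji)/eqP-> := eq_ab j.
exists i; rewrite lt_ab; apply/forallP => j; apply/implyP => ji.
by apply/eqP/val_inj/eq_ab.
Qed.

Lemma ltlex_irr a : ltlex a a = false.
Proof. by apply/ltlexP => -[i]; rewrite ltnn. Qed.

Lemma ltlex_trans a b c : ltlex a b -> ltlex b c -> ltlex a c.
Proof.
move=> /ltlexP[i lt_ab eq_ab] /ltlexP[j lt_bc eq_bc].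
case: (ltngtP i j) => [ij|ji|/val_inj ij].
- apply/ltlexP; exists i; first by rewrite -(eq_bc _ ij).
  by move=> k ki; rewrite eq_ab // eq_bc //; apply: ltn_trans ki ij.
- apply/ltlexP; exists j; first by rewrite (eq_ab _ ji).
  by move=> k kj; rewrite eq_ab ?eq_bc //; apply: ltn_trans kj ji.
- subst j; apply/ltlexP; exists i; first exact: ltn_trans lt_ab lt_bc.
  by move=> k ki; rewrite eq_ab // eq_bc.
Qed.

Lemma ltlex_asym a b : ltlex a b -> ltlex b a -> False.
Proof. by move=> ab ba; have := ltlex_trans ab ba; rewrite ltlex_irr. Qed.

Lemma ltlex_total a b : [\/ a = b, ltlex a b | ltlex b a].
Proof.
have [/existsP[i0 ab0]|] := boolP [exists i, a i != b i]; last first.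
  rewrite negb_exists => /forallP eq_ab; constructor 1; apply/ffunP => k.
  by apply/eqP; rewrite -[_ == _]negbK.
case: (@arg_minnP _ _ (fun i => a i != b i) (@nat_of_ord m) ab0)
  => i ab_i min_i.
have eq_ab (j : 'I_m) : j < i -> a j = b j :> nat.
  by move=> ji; congr val; apply: contraTeq ji => /min_i; rewrite -leqNgt.
case: (ltngtP (a i) (b i)) => [lt_ab|lt_ba|/val_inj ab].
- by constructor 2; apply/ltlexP; exists i.
- by constructor 3; apply/ltlexP; exists i => // j /eq_ab.
- by rewrite ab eqxx in ab_i.
Qed.

Lemma leP_lex a b : a <=P b -> a = b \/ ltlex a b.
Proof.
move=> /lePP ab; case: (ltlex_total a b) => [|| /ltlexP[i]]; [by left|by right|].
by rewrite ltnNge ab.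
Qed.

(** * Sub-boxes *)

(** The box on the coordinates in [A], kept inside the full box by freezing the
    other coordinates at those of [p]: a slice of a sub-box in any direction is
    then a sub-box of the same type. *)
Definition subbox A p : {set box d} :=
  [set a : box d | [forall i, (i \notin A) ==> (a i == p i)]].

Lemma subboxP A p a :
  reflect (forall i, i \notin A -> a i = p i :> nat) (a \in subbox A p).
Proof.
rewrite inE; apply: (iffP forallP) => ap i; last first.
  by apply/implyP => iA; apply/eqP/val_inj/ap.
by move=> iA; have /implyP/(_ iA)/eqP-> := ap i.
Qed.

Lemma upd_subbox A p a i n :
  i \in A -> n < d i -> a \in subbox A p -> upd a i n \in subbox A p.
Proof.
move=> iA n_lt /subboxP ap; apply/subboxP => k kA; rewrite updE //.
by case: eqP => [ki|_]; [rewrite ki iA in kA|apply: ap].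
Qed.

Lemma subbox_slice A p i (j : 'I_(d i)) a : i \in A ->
  (a \in subbox (A :\ i) (upd p i j)) = (a \in subbox A p) && (a i == j).
Proof.
move=> iA; apply/subboxP/andP => [ap|[/subboxP ap /eqP aij] k].
  split; last by apply/eqP/val_inj; rewrite /= ap ?setD11 // updE // eqxx.
  apply/subboxP => k kA; rewrite ap ?inE ?(negPf kA) ?andbF // updE //.
  by case: eqP => // ki; rewrite ki iA in kA.
rewrite !inE negb_and negbK updE //; case: eqP => [->|_] /=; first by rewrite aij.
exact: ap.
Qed.

(** * Up-closed sets, lexicographic segments and domination *)

Definition upclosed B U :=
  U \subset B /\ {in U & B, forall a b, a <=P b -> b \in U}.

Definition lexclosed B U :=
  U \subset B /\ {in U & B, forall a b, ltlex a b -> b \in U}.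

(** The comparison of degree distributions that every improvement respects. *)
Definition dominates L U :=
  #|L| = #|U| /\ forall v, #|U :&: deg_le d v| <= #|L :&: deg_le d v|.

Lemma dominates_refl U : dominates U U.
Proof. by split. Qed.

Lemma dominates_trans V L U : dominates L V -> dominates V U -> dominates L U.
Proof.
move=> [LV LVd] [VU VUd]; split; first by rewrite LV.
by move=> v; apply: leq_trans (VUd v) (LVd v).
Qed.

(** Reverse lexicographic rank, and the measure that improvements decrease. *)
Definition rk a := #|[set b | ltlex a b]|.
Definition weight U := \sum_(a in U) rk a.

Lemma rk_lt a b : ltlex a b -> rk b < rk a.
Proof.
move=> ab; apply: proper_card; apply/properP; split.
  by apply/subsetP => c; rewrite !inE; apply: ltlex_trans.
by exists b; rewrite !inE ?ltlex_irr.
Qed.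

(** Both the exchange of one point and the folding along a diagonal move points
    by an injection, which makes size and degrees immediate. *)
Lemma dominates_imset (f : box d -> box d) U :
    {in U &, injective f} -> {in U, forall a, deg (f a) <= deg a} ->
  dominates (f @: U) U.
Proof.
move=> f_inj f_deg; split; first exact: card_in_imset.
move=> v; rewrite -(card_in_imset (D := mem (U :&: deg_le d v)) (f := f)).
  apply/subset_leq_card/subsetP => _ /imsetP[a + ->].
  rewrite !inE => /andP[aU av]; rewrite imset_f //=.
  by apply: leq_trans av; apply: f_deg.
by move=> a b; rewrite !inE => /andP[aU _] /andP[bU _]; apply: f_inj.
Qed.

Lemma weight_imset (f : box d -> box d) U y :
    {in U &, injective f} -> {in U, forall a, f a = a \/ ltlex a (f a)} ->
    y \in U -> ltlex y (f y) ->
  weight (f @: U) < weight U.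
Proof.
move=> f_inj f_lex yU fy; rewrite /weight big_imset //=.
rewrite (bigD1 y) //= [ltnRHS](bigD1 y) //= -addSn leq_add ?rk_lt //.
apply: leq_sum => a /andP[aU _]; case: (f_lex a aU) => [->//|/rk_lt/ltnW//].
Qed.

(** The points of [L] outside [U] are lexicographically above the points of [U]
    outside [L], and there are equally many of both. *)
Lemma lexclosed_weight B L U : lexclosed B L -> U \subset B -> #|L| = #|U| ->
  weight L <= weight U ?= iff (L == U).
Proof.
move=> [LB Lcl] UB LU.
have [->|neLU] := eqVneq L U; first by split; rewrite ?eqxx.
suff lt_w : weight L < weight U by split; [exact: ltnW | rewrite ltn_eqF].
have cD : #|L :\: U| = #|U :\: L|.
  by move: LU; rewrite -(cardsID U L) -(cardsID L U) setIC => /addnI.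
(* The greatest point of [U :\: L] separates the two differences by rank. *)
have /set0Pn[b0 b0P] : U :\: L != set0.
  apply: contra neLU; rewrite setD_eq0 => sUL.
  by rewrite eq_sym eqEcard sUL LU leqnn.
case: (arg_minnP rk b0P) => b bUL b_min.
rewrite /weight (big_setID U) /= [ltnRHS](big_setID L) /= setIC ltn_add2l.
apply: (@leq_trans (#|U :\: L| * rk b)); last first.
  by rewrite -sum_nat_const; apply: leq_sum => a; apply: b_min.
rewrite -cD -sum_nat_const.
have [a0 a0P] : exists a, a \in L :\: U.
  by apply/set0Pn; rewrite -card_gt0 cD; apply/card_gt0P; exists b.
have lt_ab a : a \in L :\: U -> rk a < rk b.
  move=> /setDP[aL aU]; case/setDP: bUL => bU bL.
  apply: rk_lt; case: (ltlex_total a b) => [ab|ab|//].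
    by rewrite ab bU in aU.
  by move: bL; rewrite (Lcl a b) // (subsetP UB _ bU).
rewrite (bigD1 a0) //= [ltnRHS](bigD1 a0) //= -addSn leq_add ?lt_ab //.
by apply: leq_sum => a /andP[/lt_ab/ltnW].
Qed.

(** * Compression of slices *)

Definition slice i (j : 'I_(d i)) U : {set box d} := [set a in U | a i == j].

Lemma big_slice U i (F : box d -> nat) :
  \sum_(a in U) F a = \sum_(j < d i) \sum_(a in slice j U) F a.
Proof.
rewrite (partition_big (fun a : box d => a i) predT) //=.
by apply: eq_bigr => j _; apply: eq_bigl => a; rewrite inE.
Qed.

Lemma card_slice U i : #|U| = \sum_(j < d i) #|slice j U|.
Proof.
by rewrite -sum1_card (big_slice U i); apply: eq_bigr => j _; rewrite sum1_card.
Qed.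

Lemma upd_id a i (j : 'I_(d i)) : a i = j -> upd a i j = a.
Proof. by move=> aj; apply: boxP => k; rewrite updE //; case: eqP => // ->; rewrite aj. Qed.

Lemma upd_upd a i (j j' : 'I_(d i)) : upd (upd a i j) i j' = upd a i j'.
Proof. by apply: boxP => k; rewrite !updE //; case: eqP. Qed.

Lemma upd_inj i (j j' : 'I_(d i)) a b :
  a i = j -> b i = j -> upd a i j' = upd b i j' -> a = b.
Proof.
by move=> aj bj eq_ab; rewrite -(upd_id aj) -(upd_id bj) -(upd_upd a j') eq_ab upd_upd.
Qed.

Lemma upd_eq a i (j : 'I_(d i)) : upd a i j i = j.
Proof. by apply: val_inj; rewrite /= updE // eqxx. Qed.

Lemma upd_ltlex a b i (j j' : 'I_(d i)) :
  a i = j -> b i = j -> ltlex a b -> ltlex (upd a i j') (upd b i j').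
Proof.
move=> aj bj /ltlexP[k lt_ab eq_ab]; apply/ltlexP; exists k => [|k' /eq_ab eq_k].
  by rewrite !updE //; case: eqP lt_ab => // ->; rewrite aj bj ltnn.
by rewrite !updE // eq_k.
Qed.

Lemma upd_leP a b i (j j' : 'I_(d i)) :
  a <=P b -> j <= j' -> upd a i j <=P upd b i j'.
Proof.
move=> /lePP ab jj; apply/lePP => k; rewrite !updE //.
by case: eqP => // ki; apply: ab.
Qed.

(** Up-closedness makes the slices of [U] grow with [j]; hence so do the sizes
    of the segments that replace them, and segments of growing sizes are nested
    once they are moved to a common slice. This is why the union of the segments
    is up-closed again. *)
Lemma slice_compression A p i U a b :
    i \in A -> upclosed (subbox A p) U ->
    (forall q V, upclosed (subbox (A :\ i) q) V ->
       exists L, lexclosed (subbox (A :\ i) q) L /\ dominates L V) ->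
    a \in subbox A p -> a \notin U -> b \in U -> a i = b i -> ltlex b a ->
  exists W, [/\ upclosed (subbox A p) W, dominates W U & weight W < weight U].
Proof.
move=> iA [UB Ucl] IH aB aU bU ab_i ba.
pose B (j : 'I_(d i)) := subbox (A :\ i) (upd p i j).
have inB j c : (c \in B j) = (c \in subbox A p) && (c i == j).
  exact: subbox_slice.
have Uj_up j : upclosed (B j) (slice j U).
  split; first by apply/subsetP => c; rewrite inB inE => /andP[/(subsetP UB)-> ->].
  move=> c e; rewrite inB inE [in X in _ -> _ -> _ -> X]inE.
  by move=> /andP[cU _] /andP[eB ->] /(Ucl c e cU eB)->.
have [L LP] := fin_all_exists (fun j => IH _ _ (Uj_up j)).
have LB j : L j \subset B j by have [[]] := LP j.
have Li j c : c \in L j -> c i = j.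
  by move=> /(subsetP (LB j)); rewrite inB => /andP[_ /eqP].
pose W := [set c : box d | c \in L (c i)].
have inW c : (c \in W) = (c \in L (c i)) by rewrite inE.
have WL j : slice j W = L j.
  apply/setP => c; rewrite !inE; case: eqP => [->|ne_cj]; first by rewrite andbT.
  by rewrite andbF; apply/esym/negP => /Li.
(* Moving slice [j] up to slice [j'] stays inside [U]. *)
have L_le (j j' : 'I_(d i)) : j <= j' -> #|L j| <= #|L j'|.
  move=> jj; rewrite !(LP _).2.1 -(card_in_imset (f := fun c => upd c i j')).
    apply/subset_leq_card/subsetP => _ /imsetP[c + ->].
    rewrite !inE upd_eq eqxx andbT => /andP[cU /eqP cj].
    apply: (Ucl c) => //; first by apply: upd_subbox => //; apply: (subsetP UB).
    by rewrite -{1}(upd_id cj); apply: upd_leP => //; apply: leP_refl.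
  move=> c e; rewrite !inE => /andP[_ /eqP cj] /andP[_ /eqP ej].
  exact: upd_inj cj ej.
exists W; split.
- split; first by apply/subsetP => c; rewrite inW => /(subsetP (LB _)); rewrite inB => /andP[].
  move=> c e; rewrite !inW => cL eB ce.
  set j := c i in cL; set j' := e i.
  have jj : j <= j' by move/lePP: ce.
  pose c' := upd c i j'.
  have cB : c \in subbox A p by move/(subsetP (LB _)): cL; rewrite inB => /andP[].
  (* Otherwise the segment [L j'] lies above [c'], and moving it down to slice
     [j] embeds it in [L j] without hitting [c]: [L j'] would be too small. *)
  have c'L : c' \in L j'.
    apply: contraLR (L_le _ _ jj) => c'L; rewrite -ltnNge.
    rewrite -(card_in_imset (f := fun u => upd u i j) (D := mem (L j'))); last first.
      by move=> u v uL vL; apply: upd_inj (Li _ _ uL) (Li _ _ vL).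
    apply: proper_card; apply/properP; split; last first.
      exists c => //; apply/imsetP => -[u uL cu]; case/negP: c'L.
      by rewrite /c' cu upd_upd (upd_id (Li _ _ uL)).
    apply/subsetP => _ /imsetP[u uL ->].
    have [[_ Ljcl] _] := LP j; have [[_ Lj'cl] _] := LP j'.
    have uB : u \in subbox A p by move/(subsetP (LB _)): uL; rewrite inB => /andP[].
    apply: (Ljcl c) => //; first by rewrite -/(B j) inB upd_eq eqxx andbT upd_subbox.
    rewrite -(@upd_id c i j) // -(upd_upd c j').
    apply: upd_ltlex (upd_eq _ _) (Li _ _ uL) _.
    case: (ltlex_total (upd c i j') u) => // [eq_u|lt_u].
      by rewrite -/c' in eq_u; rewrite eq_u uL in c'L.
    case/negP: c'L; apply: (Lj'cl u) => //.
    by rewrite -/(B j') inB upd_eq eqxx andbT upd_subbox.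
  have c'e : c' <=P e by rewrite -(@upd_id e i j') //; apply: upd_leP.
  rewrite -/j'; have [ec|lt_e] := leP_lex c'e; first by rewrite -[e]ec.
  have [[_ Lcl] _] := LP j'; apply: (Lcl c') => //.
  by rewrite -/(B j') inB eqxx andbT.
- split; first by rewrite !(card_slice _ i); apply: eq_bigr => j _; rewrite WL (LP j).2.1.
  move=> v; rewrite !(card_slice _ i); apply: leq_sum => j _.
  have sI V : slice j (V :&: deg_le d v) = slice j V :&: deg_le d v.
    by apply/setP => c; rewrite !inE andbAC.
  by rewrite !sI WL; have [_ [_]] := LP j.
- rewrite /weight !(big_slice _ i).
  have lw j := lexclosed_weight (LP j).1 (Uj_up j).1 (LP j).2.1.
  rewrite (eq_bigr (fun j => weight (L j))); last by move=> j _; rewrite WL.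
  rewrite ltn_neqAle (leqif_sum (fun j _ => lw j)) (leqif_sum (fun j _ => lw j)).
  rewrite andbT; apply/negP => /forall_inP/(_ (a i) isT)/eqP LU.
  have bL : b \in L (a i) by rewrite LU inE bU ab_i eqxx.
  have [[_ Lcl] _] := LP (a i).
  have : a \in L (a i) by apply: (Lcl b) => //; rewrite -/(B _) inB aB eqxx.
  by rewrite LU inE (negPf aU).
Qed.

(** * The least point inside and the greatest point outside *)

Lemma leq_subr_swap r n q : r <= n -> q <= n - r -> r <= n - q.
Proof. lia. Qed.

Lemma sub_swap_add n q r t : r <= n -> t <= q -> q - t <= n -> n - r <= q ->
  n - (q - t) + (q - (n - r)) = r + t.
Proof. lia. Qed.

(** A difference at the first free coordinate decides the order. *)
Lemma ltlex_first A p a b k :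
    a \in subbox A p -> b \in subbox A p -> (forall i, i \in A -> k <= i) ->
  a k < b k -> ltlex a b.
Proof.
move=> /subboxP ap /subboxP bp k_min lt_ab; apply/ltlexP; exists k => // j jk.
have jA : j \notin A by apply: contraL jk => /k_min; rewrite -leqNgt.
by rewrite ap ?bp.
Qed.

Section Extremal.
Variables (A : {set 'I_m}) (p : box d) (U : {set box d}) (x y : box d).
Hypothesis U_up : upclosed (subbox A p) U.
Hypotheses (xB : x \in subbox A p) (xU : x \notin U) (yU : y \in U).
Hypothesis x_max : {in subbox A p, forall b, ltlex x b -> b \in U}.
Hypothesis y_min : {in U, forall a, ~~ ltlex a y}.
Hypothesis yx : ltlex y x.

Let UB : {subset U <= subbox A p}. Proof. exact/subsetP/U_up.1. Qed.
Let yB : y \in subbox A p. Proof. exact: UB. Qed.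
Let Ucl := U_up.2.

(** Removing a least point and adding a greatest missing one preserves
    up-closedness, because the lexicographic order extends [<=P]. *)
Lemma extremal_exchange : deg x <= deg y ->
  exists W, [/\ upclosed (subbox A p) W, dominates W U & weight W < weight U].
Proof.
move=> deg_xy; pose f a := if a == y then x else a.
have f_inj : {in U &, injective f}.
  move=> a b aU bU; rewrite /f; case: eqP => [->|_]; case: eqP => [->|_] // ab.
    by move: xU; rewrite ab bU.
  by move: xU; rewrite -ab aU.
exists (f @: U); split.
- split.
    by apply/subsetP => _ /imsetP[a aU ->]; rewrite /f; case: eqP => // _; apply: UB.
  move=> _ b /imsetP[c cU ->] bB cb.
  have [->|neq_bx] := eqVneq b x; first by apply/imsetP; exists y; rewrite // /f eqxx.
  suff [bU neq_by] : b \in U /\ b != y.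
    by apply/imsetP; exists b; rewrite // /f (negPf neq_by).
  move: cb; rewrite /f; case: eqP => [_|neq_cy] /[dup] /leP_lex[eq_b|lt_b] cb.
  + by rewrite eq_b eqxx in neq_bx.
  + split; first exact: x_max.
    by apply/eqP => b_y; rewrite b_y in lt_b; apply: (ltlex_asym yx lt_b).
  + by rewrite -eq_b; split=> //; apply/eqP.
  + split; first exact: Ucl cb.
    by apply: contra (y_min cU) => /eqP <-.
- apply: dominates_imset => // a aU; rewrite /f.
  by case: eqP => // ->.
- apply: (weight_imset (y := y)) => //; last by rewrite /f eqxx.
  by move=> a aU; rewrite /f; case: eqP => [->|]; [right|left].
Qed.

(** * Folding in two dimensions *)

Section TwoCoordinates.
Variables e l : 'I_m.
Hypotheses (eA : e \in A) (lA : l \in A) (el : e < l).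
Hypothesis A_el : forall i, i \in A -> i = e \/ i = l.
Hypothesis d_el : d e <= d l.
Hypothesis deg_yx : deg y < deg x.

Let leB a b : a \in subbox A p -> b \in subbox A p -> a e <= b e -> a l <= b l ->
  a <=P b.
Proof.
move=> /subboxP ap /subboxP bp ae al; apply/lePP => i.
have [/A_el[]->//|iA] := boolP (i \in A).
by rewrite ap ?bp.
Qed.

Let eqB a b : a \in subbox A p -> b \in subbox A p ->
  a e = b e :> nat -> a l = b l :> nat -> a = b.
Proof.
move=> /subboxP ap /subboxP bp ae al; apply: boxP => i.
have [/A_el[]->//|iA] := boolP (i \in A).
by rewrite ap ?bp.
Qed.

Let degB a b : a \in subbox A p -> b \in subbox A p ->
  deg a + (b e + b l) = deg b + (a e + a l).
Proof.
move=> /subboxP ap /subboxP bp; have le : l != e by apply: contraTneq el => ->; rewrite ltnn.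
rewrite /deg (bigD1 e) //= (bigD1 l) //= [\sum_(i < m) b i](bigD1 e) //=.
rewrite [\sum_(i < m | i != e) b i](bigD1 l) //=.
rewrite (eq_bigr (fun i => nat_of_ord (b i))).
  by set s := (\sum_(i < m | _) _); lia.
move=> i /andP[ie il]; have iA : i \notin A.
  by apply/negP => /A_el[] /eqP; [apply/negP | apply/negP].
by rewrite ap ?bp.
Qed.

Let lexB a b : a \in subbox A p -> b \in subbox A p -> a e < b e -> ltlex a b.
Proof.
move=> aB bB; apply: ltlex_first aB bB _ => i /A_el[]-> //; exact: ltnW.
Qed.

Let ye_min a : a \in U -> y e <= a e.
Proof.
by move=> aU; have := y_min aU; apply: contraR; rewrite -ltnNge; apply: lexB; rewrite ?UB.
Qed.

Let ye_lt : y e < x e.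
Proof.
have [lt_yx|] := ltnP (y e) (x e); first by [].
rewrite leq_eqVlt => /predU1P[eq_yx|lt_xy]; last first.
  by case: (ltlex_asym yx); apply: lexB.
case/ltlexP: yx => i lt_i _; case/negP: xU; apply: (Ucl yU xB).
have il : i = l.
  have [/A_el[ie|//]|iA] := boolP (i \in A).
    by move: lt_i; rewrite ie eq_yx ltnn.
  by move: lt_i; rewrite (subboxP _ _ _ xB i iA) (subboxP _ _ _ yB i iA) ltnn.
by apply: leB; rewrite // ?eq_yx // -il ltnW.
Qed.

Let xl_lt : x l < y l.
Proof.
rewrite ltnNge; apply/negP => le_yx; case/negP: xU; apply: (Ucl yU xB).
by apply: leB => //; apply: ltnW.
Qed.

Let Uge a b : a \in U -> b \in subbox A p -> a e <= b e -> a l <= b l -> b \in U.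
Proof. by move=> aU bB ae al; apply: (Ucl aU bB); apply: leB => //; apply: UB. Qed.

(** [X] and [C] bound the part of the board that is folded: rows above [X] are
    full, and the depth below [X] of any row that meets [U] fits into the
    columns up to [C]. *)
Section Reflection.
Variables X C : nat.
Hypotheses (X_lt : X < d e) (C_lt : C < d l).
Hypothesis X_max : {in subbox A p, forall b, X < b e -> b \in U}.
Hypothesis U_bound : {in U, forall a, X - a e <= C}.

(** In terms of the distances [X - a e] and [C - a l] to the corner [(X, C)], the
    reflection swaps the two distances. *)
Definition reflection a : box d :=
  upd (upd a e (X - (C - a l))) l (C - (X - a e)).

Lemma reflE a : (reflection a e = X - (C - a l) :> nat) *
  (reflection a l = C - (X - a e) :> nat).
Proof.
have ltX : X - (C - a l) < d e by apply: leq_ltn_trans X_lt; apply: leq_subr.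
have ltC : C - (X - a e) < d l by apply: leq_ltn_trans C_lt; apply: leq_subr.
by split; rewrite /reflection !updE // eqxx //; case: eqP el => // ->; rewrite ltnn.
Qed.

Lemma reflB a : a \in subbox A p -> reflection a \in subbox A p.
Proof.
move=> aB; apply: upd_subbox => //; first by apply: leq_ltn_trans C_lt; apply: leq_subr.
by apply: upd_subbox => //; apply: leq_ltn_trans X_lt; apply: leq_subr.
Qed.

(** The points of [U] that move: the reflection of [a] is lexicographically
    larger than [a] exactly when [C - a l < X - a e]. *)
Definition reflected a :=
  [&& a e <= X, a l <= C, C - a l < X - a e & reflection a \notin U].
Definition fold a := if reflected a then reflection a else a.

Lemma reflK a : a \in subbox A p ->
  a e <= X -> a l <= C -> C - a l <= X -> X - a e <= C ->
  reflection (reflection a) = a.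
Proof.
by move=> aB aX aC qX pC; apply: eqB; rewrite ?reflB // !reflE subKn ?subKn.
Qed.

Lemma fold_inj : {in U &, injective fold}.
Proof.
have fold1 a b : a \in U -> b \in U -> reflected a -> ~~ reflected b -> fold a <> fold b.
  move=> aU bU Ra; rewrite /fold Ra => /negPf-> ab.
  by move: Ra; rewrite /reflected ab bU !andbF.
move=> a b aU bU ab.
have [Ra|Ra] := boolP (reflected a); have [Rb|Rb] := boolP (reflected b).
- have fK c : c \in U -> reflected c -> reflection (fold c) = c.
    move=> cU /[dup] Rc /and4P[cX cC qp _]; rewrite /fold Rc reflK ?UB ?U_bound //.
    by apply: leq_trans (ltnW qp) _; apply: leq_subr.
  by rewrite -(fK a) // ab fK.
- by case: (fold1 a b).
- by case: (fold1 b a).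
- by move: ab; rewrite /fold (negPf Ra) (negPf Rb).
Qed.

(** Of each pair of mirror points, [fold @: U] contains the larger one as soon as
    [U] contains either, and the smaller one only when [U] contains both. *)
Lemma fold_upclosed : upclosed (subbox A p) (fold @: U).
Proof.
split.
  by apply/subsetP => _ /imsetP[a /UB aB ->]; rewrite /fold; case: ifP => // _; apply: reflB.
move=> _ b /imsetP[c cU ->] bB /lePP cb.
have cB := UB cU; have cbe := cb e; have cbl := cb l => {cb}.
have RbB := reflB bB.
have [bU|bU] := boolP (b \in U).
  have [Rb|Rb] := boolP (reflected b); last first.
    by apply/imsetP; exists b; rewrite // /fold (negPf Rb).
  case/and4P: Rb => bX bC qp /negP[].
  move: cbe cbl; rewrite /fold; case: ifP => [/and4P[cX cC cqp _]|Rc] cbe cbl.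
    rewrite !reflE leq_subCl in cbe; rewrite !reflE leq_subCl in cbl.
    by apply: (Uge cU) => //; rewrite !reflE leq_subr_swap.
  have [Rc'|Rc'] := boolP (reflection c \in U).
    by apply: (Uge Rc') => //; rewrite !reflE !leq_sub2l.
  have [cX cC] := (leq_trans cbe bX, leq_trans cbl bC).
  move: Rc; rewrite /reflected Rc' cX cC andbT /= => /negbT; rewrite -leqNgt => pq_c.
  have p_le : X - b e <= X - c e by rewrite leq_sub2l.
  apply: (Uge cU) => //; rewrite !reflE leq_subr_swap //.
    exact: leq_trans (ltnW qp) p_le.
  exact: leq_trans p_le pq_c.
move: cbe cbl; rewrite /fold; case: ifP => [/and4P[cX cC cqp _]|Rc] cbe cbl; last first.
  by case/negP: bU; apply: (Uge cU).
rewrite !reflE leq_subCl in cbe; rewrite !reflE leq_subCl in cbl.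
have bX : b e <= X.
  by rewrite leqNgt; apply: contra bU; apply: X_max.
have cbl_gt : b l < c l.
  rewrite ltnNge; apply: contra bU => le_l; apply: (Uge cU) => //.
  by rewrite -(leq_sub2lE _ cX) ltnW // (leq_ltn_trans cbe).
have RbU : reflection b \in U.
  by apply: (Uge cU) => //; rewrite !reflE leq_subr_swap.
have qX : C - b l <= X := leq_trans cbl (leq_subr _ _).
have pC : X - b e <= C := leq_trans cbe (leq_subr _ _).
have bC : b l <= C := leq_trans (ltnW cbl_gt) cC.
have RK : reflection (reflection b) = b by apply: reflK.
apply/imsetP; exists (reflection b) => //; rewrite /fold /reflected RK bU !reflE.
by rewrite !leq_subr !subKn // (leq_ltn_trans cbe) // ltn_sub2lE.
Qed.

Lemma fold_deg : {in U, forall a, deg (fold a) = deg a}.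
Proof.
move=> a aU; rewrite /fold; case: ifP => // /and4P[aX aC qp _].
have := degB (reflB (UB aU)) (UB aU); rewrite !reflE.
by rewrite sub_swap_add ?U_bound // ?(leq_trans (ltnW qp) (leq_subr _ _)) // => /addIn.
Qed.

Lemma fold_lex : {in U, forall a, reflected a -> ltlex a (fold a)}.
Proof.
move=> a aU Ra; rewrite /fold Ra; case/and4P: Ra => _ _ qp _.
by apply: lexB; rewrite ?reflB ?UB // reflE ltn_subCr.
Qed.

Lemma fold_improves a : a \in U -> reflected a ->
  exists W, [/\ upclosed (subbox A p) W, dominates W U & weight W < weight U].
Proof.
move=> aU Ra; exists (fold @: U); split; first exact: fold_upclosed.
  by apply: dominates_imset fold_inj _ => b /fold_deg->.
apply: (weight_imset fold_inj _ aU); last exact: fold_lex.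
move=> b bU; have [Rb|Rb] := boolP (reflected b); first by right; apply: fold_lex.
by left; rewrite /fold (negPf Rb).
Qed.

End Reflection.

(** The reflection has to move a point of [U] to the missing point [x]. As [x] is
    in row [X = x e], its mirror point is in column [C], and it lies above [y],
    hence in [U], when [C] is at least [y l] and at most [x l + x e - y e];
    [deg y < deg x] leaves room for that. The largest such column is taken, so
    that every row from [y e] up to [X] can be reflected, which is where
    [d e <= d l] enters. *)
Lemma reflection_compression :
  exists W, [/\ upclosed (subbox A p) W, dominates W U & weight W < weight U].
Proof.
pose C := minn (d l).-1 (x l + x e - y e).
have deg_eq := degB xB yB.
have [ye xl] := (ye_lt, xl_lt); have [yl_d xe_d] := (ltn_ord (y l), ltn_ord (x e)).
have C_lt : C < d l by rewrite /C; lia.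
have U_bound : {in U, forall a, x e - a e <= C}.
  by move=> a /ye_min; move: d_el; rewrite /C; lia.
have xC : x l < C by rewrite /C; lia.
have yC : y l <= C by move: deg_yx; rewrite /C; lia.
have Cx : C - x l <= x e - y e by rewrite leq_subLR addnBA ?geq_minr // ltnW.
have Cx' : C - x l <= x e := leq_trans Cx (leq_subr _ _).
have X_max : {in subbox A p, forall b, x e < b e -> b \in U}.
  by move=> b bB lt_b; apply: x_max => //; apply: lexB.
have [reflE' reflB'] := (reflE (ltn_ord (x e)) C_lt, reflB (ltn_ord (x e)) C_lt).
have RxU : reflection (x e) C x \in U.
  apply: (Uge yU); rewrite ?reflB' // reflE'; last by rewrite subnn subn0.
  by apply: leq_subr_swap => //; apply: ltnW.
have RRx : reflection (x e) C (reflection (x e) C x) = x.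
  by apply: reflK; rewrite // ?subnn // ltnW.
apply: (fold_improves (ltn_ord (x e)) C_lt X_max U_bound RxU).
by rewrite /reflected RRx xU !reflE' subnn subn0 subnn subKn // leq_subr leqnn subn_gt0 xC.
Qed.

End TwoCoordinates.
End Extremal.

(** * Three or more dimensions *)

Definition slice_closed A p U := forall i a b, i \in A ->
  a \in subbox A p -> b \in U -> a i = b i -> ltlex b a -> a \in U.

Lemma upd_above a i k n : n < d i -> k < i -> upd a i n k = a k.
Proof.
by move=> n_lt ki; apply: val_inj; rewrite /= updE //; case: eqP ki => // ->; rewrite ltnn.
Qed.

(** A point lexicographically between [y] and [x] is in [U] if it shares a
    coordinate with [y], and outside [U] if it shares one with [x]. So no point
    between them shares coordinates with both, and no slice has a point of the
    first kind below one of the second kind. This forces the first coordinates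
    to be consecutive, the middle ones of [x] to vanish, and the last one of [x]
    to be below that of [y]. *)
Lemma slice_closed_exchange A p U x y e k l :
    upclosed (subbox A p) U -> slice_closed A p U ->
    [/\ e \in A, k \in A & l \in A] -> e < k < l -> 1 < d k ->
    {in A, forall i, e <= i <= l} ->
    x \in subbox A p -> x \notin U -> y \in U -> ltlex y x ->
  deg x <= deg y.
Proof.
move=> [/subsetP UB _] Ucl [eA kA lA] /andP[ek kl] dk A_el xB xU yU yx.
have yB := UB _ yU; have el := ltn_trans ek kl.
have e_min i : i \in A -> e <= i by case/A_el/andP.
have sep i : i \in A -> x i != y i.
  by move=> iA; apply: contra xU => /eqP xy_i; apply: (Ucl i x y).
have ye_lt : y e < x e.
  case/ltlexP: yx => i lt_i eq_i; suff -> : e = i by [].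
  have iA : i \in A.
    apply: contraLR lt_i => iA.
    by rewrite (subboxP _ _ _ xB) // (subboxP _ _ _ yB) // ltnn.
  apply/val_inj/eqP; rewrite eqn_leq e_min //= leqNgt.
  by apply: contra (sep e eA) => /eq_i/val_inj->.
have neq_le : (l == e) = false by apply: contraTF el => /eqP->; rewrite ltnn.
have neq_lk : (l == k) = false by apply: contraTF kl => /eqP->; rewrite ltnn.
have neq_ke : (k == e) = false by apply: contraTF ek => /eqP->; rewrite ltnn.
have neq_el : (e == l) = false by rewrite eq_sym.
have neq_kl : (k == l) = false by rewrite eq_sym.
have neq_ek : (e == k) = false by rewrite eq_sym.
have between z : z \in subbox A p -> ltlex y z -> ltlex z x -> z l = y l -> z \in U.
  by move=> zB yz zx zl; apply: (Ucl l z y).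
have xe_eq : x e = (y e).+1 :> nat.
  apply/eqP; rewrite eqn_leq ye_lt andbT leqNgt; apply: contra xU => lt_e.
  have lt_d : (y e).+1 < d e := ltn_trans lt_e (ltn_ord _).
  pose z2 := upd (upd y e (y e).+1) k 0.
  pose z1 := upd (upd (upd y e (y e).+1) k 1) l (x l).
  have z1B : z1 \in subbox A p by rewrite !upd_subbox.
  have z2B : z2 \in subbox A p by rewrite !upd_subbox // ltnW.
  have z2e : z2 e = (y e).+1 :> nat.
    by rewrite !updE ?(ltnW dk) // neq_ek eqxx.
  have z1e : z1 e = (y e).+1 :> nat.
    by rewrite !updE // neq_el neq_ek eqxx.
  (* [z1] shares [l] with [x], [z2] shares [l] with [y], both share [e], and the
     middle coordinate [k] puts [z2] below [z1]. *)
  have z2U : z2 \in U.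
    apply: (Ucl l z2 y) => //; last by apply: (ltlex_first yB z2B e_min); rewrite z2e.
    by apply: val_inj; rewrite /= !updE ?(ltnW dk) // neq_lk neq_le.
  have z1U : z1 \in U.
    apply: (Ucl e z1 z2) => //; first by apply: val_inj; rewrite /= z1e z2e.
    apply/ltlexP; exists k => [|j jk].
      by rewrite !updE ?(ltnW dk) // neq_kl eqxx.
    rewrite (upd_above _ (ltn_ord _) (ltn_trans jk kl)).
    by rewrite (upd_above _ dk jk) (upd_above _ (ltnW dk) jk).
  apply: (Ucl l x z1) => //; first by apply: val_inj; rewrite /= updE // eqxx.
  by apply: (ltlex_first z1B xB e_min); rewrite z1e.
(* With [z e = x e] and [z l = y l], [z] shares coordinates with both. *)
have no_between z : z \in subbox A p -> z e = x e -> z l = y l -> ~~ ltlex z x.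
  move=> zB ze zl; apply: contra xU => zx; apply: (Ucl e x z) => //.
  by apply: between => //; apply: (ltlex_first yB zB e_min); rewrite ze.
have xl_lt : x l < y l.
  have := sep l lA; rewrite neq_ltn => /orP[//|lt_l].
  pose z := upd x l (y l).
  have zB : z \in subbox A p by rewrite upd_subbox.
  have /negP[] : ~~ ltlex z x.
    by apply: no_between => //; [apply: upd_above | apply: upd_eq].
  apply/ltlexP; exists l => [|j jl]; first by rewrite upd_eq.
  by rewrite upd_above.
have mid0 i : i \in A -> i != e -> i != l -> x i = 0 :> nat.
  move=> iA ie il; apply/eqP; rewrite -leqn0 leqNgt; apply/negP => xi_gt0.
  have i_lt : 0 < d i := leq_ltn_trans (leq0n _) (ltn_ord (x i)).
  have /andP[ei li] := A_el i iA.
  have {}ei : e < i by rewrite ltn_neqAle ei andbT eq_sym.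
  have {}li : i < l by rewrite ltn_neqAle li andbT.
  pose z := upd (upd x i 0) l (y l).
  have zB : z \in subbox A p by rewrite !upd_subbox.
  have /negP[] : ~~ ltlex z x.
    by apply: no_between => //; [rewrite !upd_above | apply: upd_eq].
  apply/ltlexP; exists i => [|j ji].
    by rewrite upd_above // updE // eqxx.
  by rewrite upd_above ?(ltn_trans ji) // upd_above.
rewrite /deg (bigD1 e) //= (bigD1 l) ?neq_le //= [leqRHS](bigD1 e) //=.
rewrite [X in _ <= _ + X](bigD1 l) ?neq_le //= !addnA leq_add //.
  by rewrite xe_eq addSn -addnS leq_add2l.
apply: leq_sum => i /andP[ie il]; have [iA|iA] := boolP (i \in A); first by rewrite mid0.
by rewrite (subboxP _ _ _ xB) // (subboxP _ _ _ yB).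
Qed.

(** * Domination by lexicographic segments *)

Hypothesis d_mono : forall i k : 'I_m, i <= k -> d i <= d k.

(** If no slice can be compressed, the extremal points [y] and [x] fall under the
    exchange or the folding, depending on the number of free coordinates. *)
Lemma improvement A p U :
    (forall i q V, i \in A -> upclosed (subbox (A :\ i) q) V ->
       exists L, lexclosed (subbox (A :\ i) q) L /\ dominates L V) ->
    upclosed (subbox A p) U -> ~ lexclosed (subbox A p) U ->
  exists W, [/\ upclosed (subbox A p) W, dominates W U & weight W < weight U].
Proof.
move=> IH U_up not_lex; have [/subsetP UB Ucl] := U_up.
have [sl|] := boolP [forall i in A, forall a in subbox A p :\: U, forall b in U,
    ~~ ((a i == b i) && ltlex b a)]; last first.
  rewrite negb_forall_in => /exists_inP[i iA].
  rewrite negb_forall_in => /exists_inP[a /setDP[aB aU]].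
  rewrite negb_forall_in => /exists_inP[b bU].
  rewrite negbK => /andP[/eqP ab ba].
  by apply: (slice_compression iA U_up _ aB aU bU ab ba) => q V; apply: IH.
have Usl : slice_closed A p U.
  move=> i a b iA aB bU ab ba; apply: contraTT sl => aU.
  rewrite negb_forall_in; apply/exists_inP; exists i => //.
  rewrite negb_forall_in; apply/exists_inP; exists a; first by apply/setDP.
  rewrite negb_forall_in; apply/exists_inP; exists b => //.
  by rewrite negbK ab eqxx.
have {not_lex} [a aU [b bD ab]] : exists2 a, a \in U & exists2 b,
    b \in subbox A p :\: U & ltlex a b.
  have [/exists_inP[a aU /exists_inP[b bD ab]]|nex] :=
      boolP [exists a in U, exists b in subbox A p :\: U, ltlex a b].
    by exists a => //; exists b.
  case: not_lex; split; first exact/subsetP.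
  move=> a b aU bB ab; apply: contraNT nex => bU.
  by apply/exists_inP; exists a => //; apply/exists_inP; exists b => //; apply/setDP.
case: (@arg_maxnP _ a (mem U) rk aU) => y /= yU y_max.
case: (@arg_minnP _ b (mem (subbox A p :\: U)) rk bD) => x /= /setDP[xB xU] x_min.
have y_min : {in U, forall c, ~~ ltlex c y}.
  by move=> c cU; apply: contraL (y_max c cU) => /rk_lt; rewrite -ltnNge.
have x_max : {in subbox A p, forall c, ltlex x c -> c \in U}.
  move=> c cB; apply: contraLR => cU.
  have cD : c \in subbox A p :\: U by apply/setDP.
  by apply: contraL (x_min c cD) => /rk_lt; rewrite -ltnNge.
have {a aU b bD ab} yx : ltlex y x.
  have bx : b = x \/ ltlex b x.
    case: (ltlex_total b x) => [||xb]; [by left|by right|].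
    by case/setDP: bD => bB /negP[]; apply: x_max.
  have ya : y = a \/ ltlex y a.
    case: (ltlex_total y a) => [||lt_ay]; [by left|by right|].
    by case/negP: (y_min a aU).
  case: bx ya ab => [->|bx] [->|ya] // ab; do ?exact: ltlex_trans ab.
    exact: ltlex_trans ab bx.
  exact: ltlex_trans ya (ltlex_trans ab bx).
have yB := UB _ yU.
have [le_xy|lt_yx] := leqP (deg x) (deg y).
  exact: (extremal_exchange U_up xB xU yU x_max y_min yx).
have [i0 lt_i0 _] := ltlexP _ _ yx.
have i0A : i0 \in A.
  apply: contraLR lt_i0 => iA.
  by rewrite (subboxP _ _ _ xB) // (subboxP _ _ _ yB) // ltnn.
case: (@arg_minnP _ i0 (mem A) (@nat_of_ord m) i0A) => e /= eA e_min.
case: (@arg_maxnP _ i0 (mem A) (@nat_of_ord m) i0A) => l /= lA l_max.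
have A_el : {in A, forall i, e <= i <= l}.
  by move=> i iA; rewrite e_min //; apply: l_max.
have [el|le] := ltnP e l; last first.
  (* In one dimension [y <=P x], contradicting [x \notin U]. *)
  case/negP: xU; apply: (Ucl y x yU xB); apply/lePP => i.
  have [iA|iA] := boolP (i \in A); last first.
    by rewrite (subboxP _ _ _ xB) // (subboxP _ _ _ yB).
  suff -> : i = i0 by apply: ltnW.
  have eq_e k : k \in A -> k = e.
    move=> /A_el/andP[ek kl]; apply/val_inj/eqP => /=.
    by rewrite eqn_leq ek (leq_trans kl le).
  by rewrite (eq_e i iA) (eq_e i0 i0A).
have [/exists_inP[k kA /andP[ke kl]]|no_mid] :=
    boolP [exists k in A, (k != e) && (k != l)].
  have /andP[ek lk] := A_el k kA.
  have ekl : e < k < l.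
    by rewrite !ltn_neqAle ek lk !andbT eq_sym ke.
  (* Side lengths increase and the first coordinates of [x] and [y] differ. *)
  have dk : 1 < d k.
    have [ek' _] := andP ekl.
    rewrite leqNgt; apply/negP => dk.
    have e0 c : c e = 0 :> nat.
      apply/eqP; rewrite -leqn0 -ltnS (leq_trans (ltn_ord _)) //.
      exact: leq_trans (d_mono (ltnW ek')) dk.
    have ye0 : x e = y e by apply: val_inj; rewrite /= !e0.
    by case/negP: xU; apply: (Usl e x y).
  move: lt_yx; rewrite ltnNge.
  by rewrite (slice_closed_exchange U_up Usl _ ekl dk A_el xB xU yU yx).
apply: (reflection_compression U_up xB xU yU x_max y_min yx eA lA el) => //.
- move=> i iA; move: no_mid; rewrite negb_exists_in => /forall_inP/(_ i iA).
  by rewrite negb_and !negbK => /orP[/eqP->|/eqP->]; [left|right].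
- exact/d_mono/ltnW.
Qed.

(** Domination is transitive and each improvement lowers the weight, so that
    repeated improvement ends in a segment. *)
Theorem lex_dominates A p U : upclosed (subbox A p) U ->
  exists L, lexclosed (subbox A p) L /\ dominates L U.
Proof.
have [n] := ubnP #|A|; elim: n A p U => // n IHn A p U /ltnSE le_An.
have [w] := ubnP (weight U); elim: w U => // w IHw U /ltnSE le_w U_up.
have [Ulex|nlex] := boolP [forall a in U, forall b in subbox A p, ltlex a b ==> (b \in U)].
  exists U; split; last exact: dominates_refl.
  split; first by case: U_up.
  by move=> a b aU bB; apply/implyP; move/forall_inP/(_ a aU)/forall_inP/(_ b bB): Ulex.
have [||W [W_up WU lt_w]] := improvement _ U_up _.
- by move=> i q V iA; apply: IHn; rewrite (cardsD1 i) iA in le_An.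
- case=> _ Ulex; case/negP: nlex; apply/forall_inP => a aU; apply/forall_inP => b bB.
  by apply/implyP; apply: Ulex.
have [|L [L_lex LW]] := IHw W _ W_up; first exact: leq_trans lt_w le_w.
by exists L; split=> //; apply: dominates_trans LW WU.
Qed.

(** * Shadows of lexicographic segments *)

Lemma gelex_trans : transitive (@gelex m d).
Proof.
move=> b a c; rewrite /gelex => /predU1P[->//|ba] /predU1P[<-|cb].
  by rewrite ba orbT.
by rewrite (ltlex_trans cb ba) orbT.
Qed.

Lemma gelex_total : total (@gelex m d).
Proof.
move=> a b; rewrite /gelex.
by case: (ltlex_total a b) => [->|->|->]; rewrite ?eqxx ?orbT.
Qed.

(** A listed point outside [L] would be preceded in the descending list by all
    of [L :&: deg_le d v], which has [r] or more points. *)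
Lemma lex_first_subset v r L :
    (forall a b, a \in L -> ltlex a b -> b \in L) ->
    r <= #|L :&: deg_le d v| ->
  lex_first d v r \subset L.
Proof.
move=> Lcl r_le; apply/subsetP => z; rewrite inE; set s := sort _ _ => z_s.
have z_in : z \in s by apply: mem_take z_s.
rewrite in_take // in z_s; apply: contraLR z_s => zL; rewrite -leqNgt.
apply: (leq_trans r_le); apply: (@leq_trans (size (take (index z s) s))); last first.
  by rewrite size_take; case: ltnP.
apply: leq_trans (card_size _); apply/subset_leq_card/subsetP => c /setIP[cL cv].
have cs : c \in s by rewrite mem_sort mem_enum.
rewrite in_take // ltnNge; apply: contra zL => le_zc.
have gelex_refl : reflexive (@gelex m d) by move=> a; rewrite /gelex eqxx.
have s_sorted : sorted (@gelex m d) s := sort_sorted gelex_total _.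
have : gelex z c.
  have := sorted_leq_nth gelex_trans gelex_refl z s_sorted.
  move=> /(_ (index z s) (index c s)); rewrite !inE !index_mem !nth_index //; exact.
by case/predU1P=> [->//|]; apply: Lcl.
Qed.

End Lex.

Theorem theorem3p9 (m : nat) (d : 'I_m -> nat)
  (d_ge1 : forall i : 'I_m, 1 <= d i)
  (d_mono : forall i j : 'I_m, i <= j -> d i <= d j)
  (v : nat) (v_le_k : v <= \sum_(i < m) (d i - 1))
  (r : nat) (S : {set box d})
  (S_sub : S \subset deg_le d v) (S_card : #|S| = r) :
  #|shadow (lex_first d v r)| <= #|shadow S|.
Proof.
pose p : box d := [ffun i => Ordinal (d_ge1 i)].
have inT a : a \in subbox setT p by apply/subboxP => i; rewrite inE.
have S_up : upclosed (subbox setT p) (shadow S).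
  split=> [|a b]; first by apply/subsetP.
  rewrite !inE => /exists_inP[c cS ca] _ ab; apply/exists_inP; exists c => //.
  exact: leP_trans ca ab.
have [L [[_ L_lex] [L_card L_deg]]] := lex_dominates d_mono S_up.
have L_cl a b : a \in L -> ltlex a b -> b \in L by move=> aL; apply: L_lex.
have M_L : lex_first d v r \subset L.
  apply: lex_first_subset => //; apply: leq_trans (L_deg v); rewrite -S_card.
  apply/subset_leq_card; rewrite subsetI S_sub andbT; apply/subsetP => a aS.
  by rewrite inE; apply/exists_inP; exists a => //; apply: leP_refl.
rewrite -L_card; apply/subset_leq_card/subsetP => a; rewrite inE.
case/exists_inP=> b /(subsetP M_L) bL /leP_lex[<- //|].
exact: L_cl.
Qed.
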